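(* Any full specification ${\rm Q}=\{q_V^z, z\in\widehat{X_V}, V\in W\}$ specifies a random field $P_{\rm Q}$ such that $Q_{P_{\rm Q}}={\rm Q}$ for $P_{\rm Q}$-a.e. boundary conditions. That is, there exists a unique (positive) random field $P$ such that for every $V\in W$ and every nonempty (finite or infinite) $S\subset\mathbb{Z}^d\setminus V$, the conditional probabilities $Q_V^z$ of $P$ satisfy $Q_V^z(x)=q_V^z(x)$ for all $x\in X^V$ and $P_S$-almost every $z\in X^S$ (hence for every $z\in X^S$ when $S$ is finite).
   Context: $X\subset\mathbb{R}$ is a finite set with $1<|X|<\infty$, and $d\ge 1$. For $S\subset\mathbb{Z}^d$, $W(S)$ is the set of all finite subsets of $S$, and $W=W(\mathbb{Z}^d)$. $X^S$ is the set of configurations on $S$ (functions $S\to X$). For disjoint $S,T$ and $x\in X^S$, $y\in X^T$, $xy\in X^{S\cup T}$ is the concatenation; $z_\Lambda$ is the restriction of $z$ to $\Lambda$. For $V\in W$, $\widehat{X_V}=\bigcup_{\emptyset\neq S\subset\mathbb{Z}^d\setminus V}X^S$ (configurations with nonempty, finite or infinite, support outside $V$). The notation $\lim_{\Lambda\uparrow S}g_\Lambda(x_\Lambda)=a$ means that $\lim_n g_{\Lambda_n}(x_{\Lambda_n})=a$ for every increasing sequence of (nonempty) finite sets $\Lambda_n$ with $\bigcup_n\Lambda_n=S$. A random field is a probability measure $P$ on $X^{\mathbb{Z}^d}$ with the $\sigma$-algebra generated by cylinder sets; $P_S$ denotes its marginal on $X^S$, $S\subset\mathbb{Z}^d$.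 All random fields are assumed positive: $P_V(x)>0$ for all $V\in W$, $x\in X^V$. Conditional probabilities of $P$: for $z\in X^S$ with $\emptyset\neq S\in W(\mathbb{Z}^d\setminus V)$, $Q_V^z(x)=P_{V\cup S}(xz)/P_S(z)$; for infinite $S\subset\mathbb{Z}^d\setminus V$, $Q_V^z(x)=\lim_{\Lambda\uparrow S}P_{V\cup\Lambda}(xz_\Lambda)/P_\Lambda(z_\Lambda)$ for $P_S$-almost every $z\in X^S$. A full specification is a system ${\rm Q}=\{q_V^z, z\in\widehat{X_V}, V\in W\}$ of strictly positive probability distributions $q_V^z$ on $X^V$ such that: 1. for all disjoint $V,I\in W$ and all $x\in X^V$, $y\in X^I$, $z\in\widehat{X_{V\cup I}}$, $q_{V\cup I}^z(xy)=q_V^z(x)\,q_I^{zx}(y)$; 2. for all $V\in W$ and nonempty $S\subset\mathbb{Z}^d\setminus V$, $q_V^z(x)=\lim_{\Lambda\uparrow S}q_V^{z_\Lambda}(x)$ for all $x\in X^V$, $z\in X^S$. *)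

(* Defs.v *)
From HB Require Import structures.
From mathcomp Require Import all_boot all_order all_algebra finmap.
From mathcomp Require Import all_classical all_reals all_analysis.

Set Implicit Arguments.
Unset Strict Implicit.
Unset Printing Implicit Defensive.

Import Order.TTheory GRing.Theory Num.Theory numFieldNormedType.Exports.

Local Open Scope classical_set_scope.
Local Open Scope ring_scope.

(* The proof that the alphabet is large enough is kept in the type: measurable
   types are pointed, so the spaces of configurations need a default letter. *)
Definition letter (R : realType) (X : {fset R}) (hX : (1 < #|` X|)%N) : Type :=
  X.

Section letter_instances.
Context (R : realType) (X : {fset R}) (hX : (1 < #|` X|)%N).

HB.instance Definition _ := Finite.on (letter hX).

Lemma letter_inhabited : exists x : letter hX, true.
Proof.
have /fset0Pn[x xX] : X != fset0 by rewrite -cardfs_gt0 ltnW.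
by exists [` xX]%fset.
Qed.

HB.instance Definition _ :=
  isPointed.Build (letter hX) (xchoose letter_inhabited).

End letter_instances.

(* Only cylinders over a single configuration on [V]: there are finitely many of
   those, so cylinders with arbitrary bases generate the same sigma-algebra. *)
Definition cylinders (I : Type) (X : Type) : set (set (I -> X)) :=
  [set B | exists2 V : set I, finite_set V &
           exists x : I -> X, B = [set f | forall i, V i -> f i = x i]].

Section configurations.
Context (d : nat) (R : realType) (X : {fset R}) (hX : (1 < #|` X|)%N).

Definition site : Type := 'rV[int]_d.

Definition field_space :=
  g_sigma_algebraType (@cylinders site (letter hX)).

Definition conf (S : set site) :=
  g_sigma_algebraType (@cylinders S (letter hX)).

Definition restr (S : set site) (w : field_space) : conf S :=
  fun i => w (\val i).

Definition sub_restr (S L : set site) (LS : L `<=` S) (z : conf S) : conf L :=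
  fun i => z (SigSub (mem_set (LS _ (set_valP i)))).

(* Only used for disjoint [S] and [T]; on an overlap [x] takes precedence. *)
Definition concat (S T : set site) (x : conf S) (y : conf T) : conf (S `|` T) :=
  fun i =>
    match pselect (S (\val i)) with
    | left Si => x (SigSub (mem_set Si))
    | right nSi =>
        y (SigSub (mem_set
          (match set_valP i with
           | or_introl Si => False_ind _ (nSi Si)
           | or_intror Ti => Ti
           end)))
    end.

(* The limit along every exhausting sequence. "Increasing" is non-strict, so
   that finite [S] is covered as well. *)
Definition lim_up (S : set site) (g : forall L : set site, conf L -> R)
    (z : conf S) (a : R) : Prop :=
  forall (L : nat -> set site) (LS : forall n, L n `<=` S),
    (forall n, finite_set (L n)) ->
    (forall n, L n !=set0) ->
    (forall n, L n `<=` L n.+1) ->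
    \bigcup_n L n = S ->
    (fun n => g (L n) (sub_restr (LS n) z)) @ \oo --> a.

Definition random_field := probability field_space R.

Definition marginal (P : random_field) (S : set site) : set (conf S) -> \bar R :=
  pushforward P (@restr S).

Arguments marginal P S : clear implicits.

Definition pmass (P : random_field) (V : set site) (x : conf V) : R :=
  fine (marginal P V [set x]).

Definition positive_field (P : random_field) : Prop :=
  forall (V : set site) (x : conf V), finite_set V -> 0 < pmass P x.

Definition cond_fin (P : random_field) (V S : set site) (z : conf S)
    (x : conf V) : R :=
  pmass P (concat x z) / pmass P z.

(* [cond_prob P z x a]: the conditional probability of [x] given [z] exists and
   is equal to [a]. *)
Definition cond_prob (P : random_field) (V S : set site) (z : conf S)
    (x : conf V) (a : R) : Prop :=
  (finite_set S -> cond_fin P z x = a) /\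
  (infinite_set S -> lim_up (fun (L : set site) (w : conf L) => cond_fin P w x)
                            z a).

(* [q V S z x] stands for q_V^z(x) with [z] supported on [S]; it only matters
   for finite [V] and nonempty [S] disjoint from [V]. *)
Definition spec_family :=
  forall V S : set site, conf S -> conf V -> R.

Definition admissible (V S : set site) : Prop :=
  [/\ finite_set V, S !=set0 & S `<=` ~` V].

Record full_specification (q : spec_family) : Prop := FullSpecification {
  spec_gt0 : forall (V S : set site) (z : conf S) (x : conf V),
    admissible V S -> 0 < q V S z x;
  spec_sum1 : forall (V S : set site) (z : conf S),
    admissible V S -> \sum_(x \in [set: conf V]) q V S z x = 1;
  spec_cat : forall (V I S : set site) (x : conf V) (y : conf I) (z : conf S),
    finite_set V -> finite_set I -> V `&` I = set0 ->
    admissible (V `|` I) S ->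
    q (V `|` I) S z (concat x y) = q V S z x * q I (S `|` V) (concat z x) y;
  spec_lim : forall (V S : set site) (z : conf S) (x : conf V),
    admissible V S ->
    lim_up (fun (L : set site) (w : conf L) => q V L w x) z (q V S z x)
}.

Definition specified_by (P : random_field) (q : spec_family) : Prop :=
  forall V S : set site, admissible V S ->
    {ae marginal P S, forall z : conf S,
      forall x : conf V, cond_prob P z x (q V S z x)}.

(* Values on non-measurable sets are unconstrained in [probability]. *)
Definition same_field (P P' : random_field) : Prop :=
  forall B : set field_space, measurable B -> P B = P' B.

End configurations.

(* Main.v *)
Require Import Defs.
From HB Require Import structures.
From mathcomp Require Import all_boot all_order all_algebra finmap.
From mathcomp Require Import all_classical all_reals all_analysis.
From mathcomp Require Import lra ring zify.

(** Conditional probabilities determine ratios of marginals: were [P] known,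
    one would have, for disjoint finite nonempty [V] and [S],
      P_V(x) / P_S(z) = q_V^z(x) / q_S^x(z),
    and summing over [x] gives
      P_S(z) = 1 / (\sum_x q_V^z(x) / q_S^x(z)),
    where [V] may be any single site [t] outside [S]. This proves uniqueness
    ([weight_unique]), since two measures that agree on cylinders are equal
    ([eq_cylinder_measure]), and it dictates the definition of the marginals in
    the existence part ([weight]).

    For existence, the ratios [ratio V S] form a multiplicative cocycle
    ([ratio_trans]): this is the consistency axiom written for the three ways of
    splitting a union of three disjoint sets. It follows that the formula above
    does not depend on the site [t] ([inv_weight_indep]); the proof compares two
    sites through a third one, and for every finite [S] there must be sites left
    outside of [S], so the lattice has to be infinite. The consistency axiom
    also gives P_{S u V}(xz) = P_S(z) q_V^z(x) ([weight_cat]); hence the P_S are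
    a consistent family of probability weights ([consistent_weight]), and the
    conditional probabilities of any measure with these marginals are the q_V^z.

    Such a measure is obtained as the image of Lebesgue measure on [0, 1[
    ([random_field_extension]): enumerate the sites, cut [0, 1[ successively
    into half-open cells whose lengths are the weights of the configurations on
    the first n sites, and map u to the configuration all of whose cells
    contain u.

    For an infinite boundary set the conditional probabilities are limits of
    those with finite boundary sets, so that there the claim is exactly the
    continuity axiom of a full specification, and it holds for every boundary
    condition.

    The algebra is carried out on functions of a configuration on the whole
    lattice that depend only on some of its coordinates ([local_spec]), which
    avoids transporting configurations along equalities between their supports;
    the last part translates to and from configurations on subsets. *)

Set Implicit Arguments.
Unset Strict Implicit.
Unset Printing Implicit Defensive.

Import Order.TTheory GRing.Theory Num.Theory.

Local Open Scope classical_set_scope.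
Local Open Scope ring_scope.

(** * Cutting an interval into consecutive pieces *)

Section subdivision.
Context (R : realFieldType) (T : eqType).
Implicit Types (s : seq T) (f : T -> R) (a b : T) (u : R).

Definition cumul s f a : R := \sum_(b <- take (index a s) s) f b.

Lemma cumul_ge0 s f a : (forall b, 0 <= f b) -> 0 <= cumul s f a.
Proof. by move=> f0; rewrite /cumul sumr_ge0. Qed.

Lemma cumulD s f a : a \in s ->
  cumul s f a + f a = \sum_(b <- take (index a s).+1 s) f b.
Proof.
move=> sa; rewrite (take_nth a) ?index_mem// nth_index//.
by rewrite -cats1 big_cat big_seq1.
Qed.

Lemma sum_take_le s f m n : (forall b, 0 <= f b) -> (m <= n)%N ->
  \sum_(b <- take m s) f b <= \sum_(b <- take n s) f b.
Proof.
move=> f0 mn; rewrite -(cat_take_drop m (take n s)) take_takel// big_cat/=.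
by rewrite lerDl sumr_ge0.
Qed.

Lemma cumulD_le s f a : (forall b, 0 <= f b) -> a \in s ->
  cumul s f a + f a <= \sum_(b <- s) f b.
Proof.
move=> f0 sa; rewrite cumulD// -[in leRHS](take_size s).
by rewrite sum_take_le// index_mem.
Qed.

Lemma cumul_cover s f u : uniq s -> 0 <= u < \sum_(b <- s) f b ->
  exists2 a, a \in s & cumul s f a <= u < cumul s f a + f a.
Proof.
elim: s u => [|c s IH] u /=; first by rewrite big_nil => _; lra.
move=> /andP[cs us]; rewrite big_cons => /andP[u0 uS].
have [ufc|fcu] := ltP u (f c).
  by exists c; rewrite ?mem_head// /cumul /= eqxx big_nil add0r u0.
have [|a sa au] := IH (u - f c) us; first by apply/andP; split; lra.
exists a; first by rewrite inE sa orbT.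
rewrite /cumul /=; case: eqP => [ca|_]; first by rewrite ca sa in cs.
by rewrite big_cons -/(cumul s f a); lra.
Qed.

Lemma cumul_disjoint s f u a b : (forall b, 0 <= f b) -> a \in s -> b \in s ->
  cumul s f a <= u < cumul s f a + f a ->
  cumul s f b <= u < cumul s f b + f b -> a = b.
Proof.
move=> f0; wlog ab : a b / (index a s <= index b s)%N.
  move=> h sa sb ha hb; have [?|/ltnW ?] := leqP (index a s) (index b s).
    exact: h.
  by apply/esym/h.
move=> sa sb; have [eab|neq] := eqVneq (index a s) (index b s).
  by move=> _ _; rewrite -(nth_index a sa) -[RHS](nth_index a sb) eab.
rewrite cumulD// => /andP[_ ua] /andP[ub _].
have lt : (index a s < index b s)%N by rewrite ltn_neqAle neq.
by exfalso; have := sum_take_le s f0 lt; rewrite -/(cumul s f b); lra.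
Qed.

End subdivision.

(** * Configurations and consistent families of weights *)

Definition update (I : eqType) (A : Type) (w : I -> A) (v : I)
    (a : A) : I -> A :=
  fun i => if i == v then a else w i.

Definition agree (I A : Type) (S : set I) (w w' : I -> A) : Prop :=
  forall i, S i -> w i = w' i.

Section agree.
Context (I : eqType) (A : Type).
Implicit Types (S : set I) (w : I -> A).

Lemma updateE w v a : update w v a v = a.
Proof. by rewrite /update eqxx. Qed.

Lemma update_id w v : update w v (w v) = w.
Proof. by apply/funext => i; rewrite /update; case: eqP => [->|]. Qed.

Lemma agree_update S w v a : ~ S v -> agree S (update w v a) w.
Proof. by move=> Sv i Si; rewrite /update; case: eqP => // iv; subst. Qed.

Lemma agree_update2 S w w' v a : agree (S `\ v) w w' ->
  agree S (update w v a) (update w' v a).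
Proof. by move=> ww' i Si; rewrite /update; case: eqP => // iv; apply: ww'. Qed.

Lemma agree_sym S w w' : agree S w w' -> agree S w' w.
Proof. by move=> h i /h. Qed.

Lemma update_comm w v v' a a' : v != v' ->
  update (update w v a) v' a' = update (update w v' a') v a.
Proof.
move=> vv'; apply/funext => i; rewrite /update.
by case: (eqVneq i v') => // ->; rewrite eq_sym (negbTE vv').
Qed.

End agree.

(** The finite-dimensional marginals of a measure on configurations. It is
    enough to require the marginalization identity for one more site. *)
Record consistent (R : realFieldType) (I : eqType) (A : finType)
    (p : set I -> (I -> A) -> R) : Prop := Consistent {
  cons_local : forall S w w', finite_set S -> agree S w w' -> p S w = p S w';
  cons_ge0 : forall S w, finite_set S -> 0 <= p S w;
  cons_set0 : forall w, p set0 w = 1;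
  cons_sum : forall S v w, finite_set S -> ~ S v ->
    \sum_(a : A) p (v |` S) (update w v a) = p S w
}.

(** * Coding configurations by points of the unit interval *)

Section coding.
Context (R : realType) (I : countType) (A : finType).
Context (p : set I -> (I -> A) -> R) (hp : consistent p) (a0 : A).
Implicit Types (w : I -> A) (n : nat) (u : R).

(** Sites are enumerated by their codes; a code that belongs to no site leaves
    the window unchanged, so that no bijection with [nat] is needed. *)
Definition window n : set I := [set i | (choice.pickle i < n)%N].

Lemma window0 : window 0 = set0.
Proof. by rewrite -subset0 => i. Qed.

Lemma windowS n v : @pickle_inv I n = Some v -> window n.+1 = v |` window n.
Proof.
move=> nv; have vn := pickle_invK (T := I) n; rewrite nv /= in vn.
apply/seteqP; split => i; rewrite /window /=.
  rewrite ltnS leq_eqVlt => /orP[/eqP iv|]; [left|by right].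
  by apply: (pcan_inj (@pickleK_inv I)); rewrite iv vn.
by case=> [->|]; [rewrite vn|exact: leqW].
Qed.

Lemma windowSN n v : @pickle_inv I n = Some v -> ~ window n v.
Proof.
move=> nv; have vn := pickle_invK (T := I) n; rewrite nv /= in vn.
by rewrite /window /= vn ltnn.
Qed.

Lemma windowS_none n : @pickle_inv I n = None -> window n.+1 = window n.
Proof.
move=> nv; apply/seteqP; split => i; rewrite /window /=; last exact: leqW.
rewrite ltnS leq_eqVlt => /orP[/eqP iv|//].
by rewrite -iv pickleK_inv in nv.
Qed.

Lemma finite_window n : finite_set (window n).
Proof.
elim: n => [|n IH]; first by rewrite window0.
case nv: (@pickle_inv I n) => [v|]; last by rewrite windowS_none.
by rewrite (windowS nv) finite_setU; split.
Qed.

Lemma sub_window V : finite_set V -> exists n, V `<=` window n.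
Proof.
move=> /finite_fsetP[B ->].
exists (\max_(i <- enum_fset B) choice.pickle (i : I)).+1 => i /= iB.
by rewrite /window /= ltnS (@leq_bigmax_seq _ (enum_fset B) xpredT).
Qed.

(** The left end of the cell of [w]: inside the cell of the restriction of [w]
    to the previous window, the letters at the new site come in the order of
    [enum A]. *)
Fixpoint lower n w : R :=
  if n isn't m.+1 then 0 else
  lower m w +
  if @pickle_inv I m is Some v
  then cumul (enum A) (fun a => p (window m.+1) (update w v a)) (w v)
  else 0.

Definition cell n w u := lower n w <= u < lower n w + p (window n) w.

Let pge0 n w : 0 <= p (window n) w.
Proof. exact/(cons_ge0 hp)/finite_window. Qed.

Let ploc n w w' : agree (window n) w w' -> p (window n) w = p (window n) w'.
Proof. by move=> h; apply: (cons_local hp) => //; exact: finite_window. Qed.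

Lemma cell0 w u : cell 0 w u = (0 <= u < 1).
Proof. by rewrite /cell window0 (cons_set0 hp) add0r. Qed.

Lemma lower_agree n w w' : agree (window n) w w' -> lower n w = lower n w'.
Proof.
elim: n => [//|n IH] ww' /=.
have sub : agree (window n) w w'.
  by move=> i; rewrite /window /= => ni; apply: ww'; rewrite /window /= ltnW.
rewrite (IH sub); case nv: (@pickle_inv I n) => [v|//].
rewrite ww'; last by rewrite (windowS nv); left.
congr (_ + cumul _ _ _); apply/funext => a; apply: ploc.
by apply: agree_update2 => i [] /ww'.
Qed.

Lemma cell_agree n w w' u : agree (window n) w w' -> cell n w u = cell n w' u.
Proof. by move=> h; rewrite /cell (lower_agree h) (ploc h). Qed.

Let psum n v w : @pickle_inv I n = Some v ->
  \sum_(a <- enum A) p (window n.+1) (update w v a) = p (window n) w.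
Proof.
move=> nv; rewrite big_enum /= (windowS nv).
by apply: cons_sum => //; [exact: finite_window|exact: windowSN].
Qed.

Let cellS_some n v w u : @pickle_inv I n = Some v -> cell n.+1 w u =
  let f a := p (window n.+1) (update w v a) in
  cumul (enum A) f (w v) <= u - lower n w < cumul (enum A) f (w v) + f (w v).
Proof.
move=> nv; rewrite /cell /= nv update_id.
by rewrite lerBrDl ltrBlDl addrA.
Qed.

Lemma cellS n w u : cell n.+1 w u -> cell n w u.
Proof.
case nv: (@pickle_inv I n) => [v|]; last first.
  by rewrite /cell /= nv windowS_none// addr0.
rewrite (cellS_some _ _ nv) /= /cell -(psum w nv).
set f := fun a => p (window n.+1) (update w v a).
have f0 b : 0 <= f b by exact: pge0.
have := cumul_ge0 (enum A) (w v) f0.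
have := cumulD_le f0 (mem_enum A (w v)).
by rewrite -/(f (w v)); lra.
Qed.

(** Cells are nested, so two cells with a common point have the same parent, and
    the pieces into which the parent is cut do not overlap. *)
Lemma cell_inj n w w' u : cell n w u -> cell n w' u -> agree (window n) w w'.
Proof.
elim: n => [|n IH] cw cw'; first by rewrite window0.
have ww' := IH (cellS cw) (cellS cw').
case nv: (@pickle_inv I n) => [v|]; last by rewrite windowS_none.
suff wv : w v = w' v by rewrite (windowS nv) => i [->//|]; exact: ww'.
move: cw cw'; rewrite !(cellS_some _ _ nv) /= (lower_agree ww').
have -> : (fun a => p (window n.+1) (update w v a)) =
          (fun a => p (window n.+1) (update w' v a)).
  apply/funext => a; apply: ploc; apply: agree_update2 => i [].
  by rewrite (windowS nv) => -[//|/ww'].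
have -> : p (window n.+1) (update w v (w v)) =
          p (window n.+1) (update w' v (w v)).
  apply: ploc; apply: agree_update2 => i [].
  by rewrite (windowS nv) => -[//|/ww'].
by apply: cumul_disjoint; rewrite ?mem_enum.
Qed.

(** By the marginalization identity the lengths of the new cells add up to the
    length of the old one, so they leave no gap. *)
Lemma cell_cover n w u v : @pickle_inv I n = Some v -> cell n w u ->
  exists a, cell n.+1 (update w v a) u.
Proof.
move=> nv cu; set f := fun a => p (window n.+1) (update w v a).
have [||a _ ha] := @cumul_cover R A (enum A) f (u - lower n w).
- exact: enum_uniq.
- by rewrite (psum w nv); move: cu; rewrite /cell; lra.
exists a; rewrite (cellS_some _ _ nv) /= updateE.
rewrite (lower_agree (agree_update _ _ (windowSN nv))).
suff -> : (fun b => p (window n.+1) (update (update w v a) v b)) = f.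
  suff -> : update (update w v a) v a = update w v a by [].
  by rewrite -[X in update _ v X](updateE w v) update_id.
apply/funext => b; congr (p _ _); apply/funext => i.
by rewrite /update; case: eqP.
Qed.

(** The n-th stage fixes the letters on [window n] only; off the window, and
    everywhere when [u] is outside of the unit interval, the letter is [a0]. *)
Fixpoint decode n u : I -> A :=
  if n isn't m.+1 then fun=> a0 else
  if @pickle_inv I m is Some v then
    update (decode m u) v
      (odflt a0 [pick a | cell m.+1 (update (decode m u) v a) u])
  else decode m u.

Definition code u : I -> A := fun i => decode (choice.pickle i).+1 u i.

Lemma cell_decode n u : 0 <= u < 1 -> cell n (decode n u) u.
Proof.
move=> u01; elim: n => [|n IH]; first by rewrite cell0.
rewrite /=; case nv: (@pickle_inv I n) => [v|]; last first.
  by move: IH; rewrite /cell /= nv windowS_none// addr0.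
have [a ha] := cell_cover nv IH.
by case: pickP => [//|/(_ a)]; rewrite ha.
Qed.

Lemma decode_stable n m u : (n <= m)%N ->
  agree (window n) (decode n u) (decode m u).
Proof.
elim: m => [|m IH]; first by rewrite leqn0 => /eqP ->.
rewrite leq_eqVlt => /orP[/eqP -> //|]; rewrite ltnS => nm i ni.
rewrite (IH nm i ni) /=; case mv: (@pickle_inv I m) => [v|//].
rewrite (agree_update _ _ (windowSN mv))//.
by move: ni; rewrite /window /= => ni; exact: leq_trans nm.
Qed.

Lemma code_decode n u : agree (window n) (code u) (decode n u).
Proof.
move=> i ni; rewrite /code; apply: decode_stable => //.
by rewrite /window /=.
Qed.

Lemma code_cell n w u : 0 <= u < 1 ->
  agree (window n) (code u) w <-> cell n w u.
Proof.
move=> u01; split => [uw|wu].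
  rewrite -(cell_agree _ uw).
  rewrite (cell_agree _ (@code_decode n u)); exact: cell_decode.
move=> i ni; rewrite (code_decode u ni).
exact: (cell_inj (cell_decode n u01) wu).
Qed.

Lemma cell_unit n w u : cell n w u -> 0 <= u < 1.
Proof. by elim: n => [|n IH]; [rewrite cell0|move=> /cellS/IH]. Qed.

Lemma decode_outside n u : ~~ (0 <= u < 1) -> decode n u = fun=> a0.
Proof.
move=> u01; elim: n => [//|n /= IH].
case: (@pickle_inv I n) => [v|//]; case: pickP => [a /cell_unit|_ /=].
  by rewrite (negbTE u01).
by rewrite IH; apply/funext => i; rewrite /update; case: eqP.
Qed.

(** What makes the coding measurable: inside the unit interval, events about
    finitely many sites are finite unions of cells. *)
Lemma finite_decode n : finite_set (range (decode n)).
Proof.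
elim: n => [|n IH] /=.
  apply: (@sub_finite_set _ _ [set (fun=> a0)]) => //.
  by move=> _ [u _ <-].
case: (@pickle_inv I n) => [v|//].
apply: (@sub_finite_set _ _
  [set update w v a | w in range (decode n) & a in [set: A]]); last first.
  by apply: finite_image2.
by move=> _ [u _ <-]; exists (decode n u) => //; eexists.
Qed.

Lemma cell_itv n w :
  [set u | cell n w u] = `[lower n w, lower n w + p (window n) w[%classic.
Proof. by apply/seteqP; split => u; rewrite /cell /= in_itv. Qed.

Lemma measurable_code i a : measurable [set u : R | code u i = a].
Proof.
set n := (choice.pickle i).+1.
have ni : window n i by rewrite /window /=.
pose F := [set w | range (decode n) w /\ w i = a].
have -> : [set u : R | code u i = a] =
    \bigcup_(w in F) [set u | cell n w u] `|`
    (if a == a0 then ~` `[0, 1[%classic else set0).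
  apply/seteqP; split => u /=.
    have [u01|u01] := boolP (0 <= u < 1) => ua.
      left; exists (decode n u); last exact: cell_decode.
      by split=> //; exists u.
    right; move: ua; rewrite /code decode_outside// => <-.
    by rewrite eqxx /= in_itv; exact/negP.
  case=> [[w [_ <-] wu]|].
    exact: ((code_cell n w (cell_unit wu)).2 wu i ni).
  case: eqP => // -> /=; rewrite in_itv /= => /negP u01.
  by rewrite /code decode_outside.
apply: measurableU; last by case: ifP => // _; apply: measurableC.
apply: fin_bigcup_measurable => [|w _]; last first.
  by rewrite cell_itv; exact: measurable_itv.
by apply: sub_finite_set (finite_decode n) => w [].
Qed.

End coding.

Arguments finite_window {I n}.

(** * Random fields with prescribed marginals *)

Lemma fsbig_finType (M : Type) (idx : M) (op : Monoid.com_law idx) (T : finType)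
    (f : T -> M) :
  \big[op/idx]_(i \in [set: T]) f i = \big[op/idx]_i f i.
Proof.
rewrite (fsbigE (index_enum T)) ?index_enum_uniq//.
  by apply: eq_bigl => i; rewrite in_setT.
by move=> i _; rewrite mem_index_enum.
Qed.

Section fields.
Context (d : nat) (R : realType) (X : {fset R}) (hX : (1 < #|` X|)%N).
Local Notation space := (field_space d hX).
Local Notation config := (site d -> letter hX).
Implicit Types (V S : set (site d)) (w : config).

Definition cylinder V w : set space := [set f | agree V f w].

Lemma measurable_cylinder V w : finite_set V -> measurable (cylinder V w).
Proof. by move=> fV; apply: sub_sigma_algebra; exists V => //; exists w. Qed.

Lemma cylinder_set0 w : cylinder set0 w = setT.
Proof. by apply/seteqP; split=> // f _ i. Qed.

Lemma cylinder_split V v w : ~ V v ->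
  cylinder V w =
  \bigcup_(a in [set: letter hX]) cylinder (v |` V) (update w v a).
Proof.
move=> Vv; apply/seteqP; split => f /=.
  move=> fw; exists (f v) => // i [->|Vi]; first by rewrite updateE.
  by rewrite (agree_update _ _ Vv)//; apply: fw.
case=> a _ fw i Vi; rewrite fw; last by right.
by rewrite (agree_update _ _ Vv).
Qed.

Lemma measure_cylinder_split (P : {measure set space -> \bar R}) V v w :
  finite_set V -> ~ V v ->
  P (cylinder V w) =
  (\sum_(a : letter hX) P (cylinder (v |` V) (update w v a)))%E.
Proof.
move=> fV Vv; rewrite (cylinder_split w Vv) measure_fin_bigcup//.
- by rewrite fsbig_finType.
- exact: finite_finset.
- apply/trivIsetP => a b _ _ ab; rewrite -subset0 => f [/= fa fb].
  have := fa v (or_introl erefl); rewrite (fb v (or_introl erefl)).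
  by rewrite !updateE => ba; move: ab; rewrite ba eqxx.
- move=> a _; apply: measurable_cylinder.
  by rewrite finite_setU; split.
Qed.

(** Cylinders together with the empty set are stable under intersection and
    generate the sigma-algebra. *)
Lemma eq_cylinder_measure (P P' : probability space R) :
  (forall V w, finite_set V -> P (cylinder V w) = P' (cylinder V w)) ->
  same_field P P'.
Proof.
move=> PP' B mB.
pose G : set (set space) := [set C | C = set0 \/
  exists2 V, finite_set V & exists w, C = cylinder V w].
have cylG V w : finite_set V -> G (cylinder V w).
  by move=> fV; right; exists V => //; exists w.
have mG : @measurable _ space = <<s G >>.
  apply/seteqP; split; apply: smallest_sub => //.

  - by move=> _ [V fV [x ->]]; apply: sub_sigma_algebra; apply: (cylG _ x).
  - exact: smallest_sigma_algebra.
  move=> C [->|[V fV [x ->]]]; first exact: measurable0.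
  exact: measurable_cylinder.
have TG : G setT.
  right; exists set0 => //; exists point.
  by apply/seteqP; split => // f _ i.
apply: (@measure_unique _ _ _ G (fun=> setT)) => //.
- move=> _ _ [->|[V fV [x ->]]] [->|[W fW [y ->]]];
    rewrite ?set0I ?setI0; try by left.
  have [xy|nxy] := pselect (agree (V `&` W) x y); last first.
    left; rewrite -subset0 => f [/= fx fy]; apply: nxy => i [Vi Wi].
    by rewrite -fx// fy.
  right; exists (V `|` W); first by rewrite finite_setU; split.
  exists (fun i => if pselect (V i) then x i else y i).
  apply/seteqP; split => f /=.
    case=> fx fy i VWi; case: pselect => [/fx//|nV].
    by case: VWi => [//|/fy].
  move=> fxy; split => i ii.
    by rewrite fxy; [case: pselect|left].
  rewrite fxy; last by right.
  by case: pselect => // Vi; apply: xy.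
- by rewrite bigcup_const.
- move=> _ [->|[V fV [w ->]]]; first by rewrite !measure0.
  exact: PP'.
- by move=> _ /=; rewrite probability_setT ltry.
Qed.

Section extension.
Context (p : set (site d) -> config -> R) (hp : consistent p).

Let a0 : letter hX := point.

Let coding : measurableTypeR R -> space := code p a0.

Lemma measurable_fun_code : measurable_fun setT coding.
Proof.
apply: (@measurability _ _ (measurableTypeR R) space _ _
  (@cylinders (site d) (letter hX))) => //.
move=> _ [_ [V fV [x ->]] <-]; rewrite setTI.
have -> : coding @^-1` [set f | forall i, V i -> f i = x i] =
    \bigcap_(i in V) [set u | code p a0 u i = x i].
  by apply/seteqP; split.
by apply: fin_bigcap_measurable => // i _; exact: measurable_code.
Qed.

HB.instance Definition _ :=
  isMeasurableFun.Build _ _ _ _ coding measurable_fun_code.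

Let unit_mI : measurable (`[0, 1[%classic : set (measurableTypeR R)).
Proof. exact: measurable_itv. Qed.

Let unit_lebesgue := mrestr (@lebesgue_measure R) unit_mI.

Let unit_lebesgueT : unit_lebesgue setT = 1%E.
Proof.
rewrite /unit_lebesgue /mrestr setTI lebesgue_measure_itv /= lte01.
by rewrite sube0.
Qed.

HB.instance Definition _ := Measure.on unit_lebesgue.

HB.instance Definition _ :=
  Measure_isProbability.Build _ _ R unit_lebesgue unit_lebesgueT.

Let field : random_field d hX := distribution unit_lebesgue coding.

Let fieldE n w : field (cylinder (window n) w) = (p (window n) w)%:E.
Proof.
transitivity (@lebesgue_measure R [set u | cell p n w u]).
  congr (lebesgue_measure _); apply/seteqP; split => u /=; rewrite in_itv /=.
    by case=> uw u01; apply/(code_cell hp a0 n w u01).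
  move=> wu; have u01 := cell_unit hp wu; split=> //.
  by apply/(code_cell hp a0 n w u01).
rewrite cell_itv lebesgue_measure_itv /= lte_fin ltrDl.
have := cons_ge0 hp w (@finite_window _ n).
rewrite le_eqVlt => /orP[/eqP <-|->]; first by rewrite ltxx.
by rewrite -EFinB addrAC subrr add0r.
Qed.

(** On windows the equality says that the length of a cell is the prescribed
    weight. An arbitrary [V] lies in a window, and removing the other sites of
    that window one at a time preserves the equality, because both sides satisfy
    the same marginalization identity. *)
Theorem random_field_extension : exists P : random_field d hX,
  forall V w, finite_set V -> P (cylinder V w) = (p V w)%:E.
Proof.
exists field => V w fV; have [n Vn] := sub_window fV.
suff H : forall k w, (k <= n)%N ->
    field (cylinder (V `|` window (n - k)) w) = (p (V `|` window (n - k)) w)%:E.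
  by have := H n w (leqnn n); rewrite subnn window0 setU0.
elim=> [|k IH] {}w; first by move=> _; rewrite subn0 (setUidr Vn) fieldE.
move=> kn; have {}IH := IH^~ (ltnW kn).
have nk : (n - k = (n - k.+1).+1)%N by lia.
move: IH; rewrite nk; set m := (n - k.+1)%N => IH.
case mv: (@pickle_inv (site d) m) => [v|]; last first.
  by move: (IH w); rewrite (windowS_none mv).
rewrite (windowS mv) setUCA in IH.
have [Vv|Vv] := pselect ((V `|` window m) v).
  have sub : [set v] `<=` V `|` window m by move=> _ ->.
  by move: (IH w); rewrite (setUidr sub).
have fVm : finite_set (V `|` window m).
  by rewrite finite_setU; split => //; exact: finite_window.
rewrite (measure_cylinder_split _ _ fVm Vv) -(cons_sum hp _ fVm Vv).
by rewrite -sumEFin; apply: eq_bigr => a _; exact: IH.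
Qed.

End extension.
End fields.

(** * Marginals from conditional probabilities *)

(** A specification as a function of configurations on the whole lattice:
    [Q V S w] stands for q_V^z(x), where [x] and [z] are the restrictions of [w]
    to [V] and [S]. *)
Record local_spec (R : realFieldType) (I : eqType) (A : finType)
    (Q : set I -> set I -> (I -> A) -> R) : Prop := LocalSpec {
  Q_local : forall V S w w', agree (V `|` S) w w' -> Q V S w = Q V S w';
  Q_gt0 : forall V S w, finite_set V -> S !=set0 -> V `<=` ~` S -> 0 < Q V S w;
  Q_sum1 : forall v S w, S !=set0 -> ~ S v ->
    \sum_(a : A) Q [set v] S (update w v a) = 1;
  Q_cat : forall V T S w, finite_set V -> finite_set T -> S !=set0 ->
    V `<=` ~` T -> V `<=` ~` S -> T `<=` ~` S ->
    Q (V `|` T) S w = Q V S w * Q T (S `|` V) w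
}.

Section local_spec.
Context (R : realFieldType) (I : eqType) (A : finType).
Context (Q : set I -> set I -> (I -> A) -> R) (hQ : local_spec Q).
Hypothesis infI : infinite_set [set: I].
Implicit Types (V S T : set I) (w : I -> A) (s t u : I).

Ltac disj := by move=> ? /=; firstorder (subst; eauto).

Lemma fresh_site S : finite_set S -> exists t, ~ S t.
Proof.
move=> fS; apply: contrapT => nS; apply: infI.
by apply: sub_finite_set fS => t _; apply: contrapT => St; apply: nS; exists t.
Qed.

Lemma Q_exchange V T S w : finite_set V -> finite_set T -> S !=set0 ->
  V `<=` ~` T -> V `<=` ~` S -> T `<=` ~` S ->
  Q V S w * Q T (S `|` V) w = Q T S w * Q V (S `|` T) w.
Proof.
move=> fV fT S0 VT VS TS.
by rewrite -!(Q_cat hQ)//; [rewrite setUC|disj].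
Qed.

(** The value that P_V(x) / P_S(z) must take. *)
Definition ratio V S w := Q V S w / Q S V w.

Lemma ratio_local V S w w' : agree (V `|` S) w w' -> ratio V S w = ratio V S w'.
Proof.
move=> ww'; rewrite /ratio (Q_local hQ ww').
by rewrite setUC in ww'; rewrite (Q_local hQ ww').
Qed.

Lemma ratio_inv V S w : ratio V S w = (ratio S V w)^-1.
Proof. by rewrite /ratio invf_div. Qed.

Lemma ratio_gt0 V S w : finite_set V -> finite_set S -> V !=set0 -> S !=set0 ->
  V `<=` ~` S -> 0 < ratio V S w.
Proof.
move=> fV fS V0 S0 VS; apply: divr_gt0; apply: (Q_gt0 hQ) => //.
by disj.
Qed.

(** Writing the conditional distribution of the union of two of the sets given
    the third in two ways yields three identities; multiplied together they
    give the cocycle relation, up to positive factors that cancel. *)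
Lemma ratio_trans V S T w : finite_set V -> finite_set S -> finite_set T ->
  V !=set0 -> S !=set0 -> T !=set0 ->
  V `<=` ~` S -> V `<=` ~` T -> S `<=` ~` T ->
  ratio V T w = ratio V S w * ratio S T w.
Proof.
move=> fV fS fT V0 S0 T0 VS VT ST.
have SV : S `<=` ~` V by disj.
have TV : T `<=` ~` V by disj.
have TS : T `<=` ~` S by disj.
have E1 := Q_exchange w fV fT S0 VT VS TS.
have E2 := Q_exchange w fV fS T0 VS VT ST.
have E3 := Q_exchange w fS fT V0 ST SV TV.
have g1 : Q V (S `|` T) w != 0.
  by rewrite gt_eqF// (Q_gt0 hQ)//; [case: S0 => i; exists i; left|disj].
have g2 : Q S (T `|` V) w != 0.
  by rewrite gt_eqF// (Q_gt0 hQ)//; [case: T0 => i; exists i; left|disj].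
have g3 : Q T (V `|` S) w != 0.
  by rewrite gt_eqF// (Q_gt0 hQ)//; [case: V0 => i; exists i; left|disj].
have h1 : Q T V w != 0 by rewrite gt_eqF// (Q_gt0 hQ).
have h2 : Q S V w != 0 by rewrite gt_eqF// (Q_gt0 hQ).
have h3 : Q T S w != 0 by rewrite gt_eqF// (Q_gt0 hQ).
rewrite (setUC S V) in E1; rewrite (setUC T S) in E2; rewrite (setUC V T) in E3.
rewrite /ratio mulf_div.
apply/eqP; rewrite eqr_div ?mulf_neq0//; apply/eqP.
apply: (mulfI g1); apply: (mulfI g2); apply: (mulfI g3).
move: (Q V S w) (Q V T w) (Q S V w) (Q S T w) (Q T S w) (Q T V w) E1 E2 E3.
move: (Q V _ w) (Q S _ w) (Q T _ w) => x y z a1 b1 c1 b2 a2 c2 E1 E2 E3.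
have -> : z * (y * (x * (b1 * (c1 * a2)))) = (b1 * y) * (c1 * z) * (a2 * x).
  by ring.
by rewrite E2 E3 -E1; ring.
Qed.

(** The value that 1 / P_S(z) must take, computed with the auxiliary site
    [t]. *)
Definition inv_weight t S w := \sum_(a : A) ratio [set t] S (update w t a).

Lemma inv_weight_local t S w w' : agree S w w' ->
  inv_weight t S w = inv_weight t S w'.
Proof.
move=> ww'; apply: eq_bigr => a _; apply: ratio_local => i.
rewrite /update; case: eqP => // it [//|]; exact: ww'.
Qed.

Let set1_0 t : [set t] !=set0. Proof. by exists t. Qed.

Lemma inv_weight_gt0 t S w : finite_set S -> S !=set0 -> ~ S t ->
  0 < inv_weight t S w.
Proof.
move=> fS S0 St; have r0 a : 0 < ratio [set t] S (update w t a).
  by apply: ratio_gt0 => // _ ->.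
rewrite /inv_weight (bigD1 (w t))//= ltr_wpDr// sumr_ge0// => a _.
exact: ltW.
Qed.

Lemma inv_weight_change t s S w : finite_set S -> S !=set0 -> ~ S t -> ~ S s ->
  t <> s -> inv_weight t S w = inv_weight t [set s] w * ratio [set s] S w.
Proof.
move=> fS S0 St Ss ts; rewrite /inv_weight mulr_suml; apply: eq_bigr => a _.
rewrite (@ratio_trans [set t] [set s] S)//; try by move=> _ ->.
congr (_ * _); apply: ratio_local; apply: agree_update.
by case=> // st; apply: ts.
Qed.

(** Sum the identity q_t^s r(s, u) = q_s^t r(t, u), which is the cocycle
    relation, over the letters at both [s] and [t]: on each side the
    conditional probability sums to 1. *)
Lemma inv_weight_swap s t u w : s <> t -> s <> u -> t <> u ->
  inv_weight s [set u] w = inv_weight t [set u] w.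
Proof.
move=> st su tu.
have Est x : Q [set t] [set s] x * ratio [set s] [set u] x =
             Q [set s] [set t] x * ratio [set t] [set u] x.
  rewrite (@ratio_trans [set s] [set t] [set u])//; try by move=> _ -> /= /esym.
  all: try by move=> _ -> /=.
  rewrite mulrA; congr (_ * _); rewrite /ratio mulrC divfK//.
  by rewrite gt_eqF// (Q_gt0 hQ)// => _ -> /= /esym.
have -> : inv_weight s [set u] w = \sum_b \sum_a
    Q [set t] [set s] (update (update w s b) t a) *
    ratio [set s] [set u] (update (update w s b) t a).
  apply: eq_bigr => b _; under eq_bigr => a _.
    rewrite (@ratio_local [set s] [set u] _ (update w s b)); last first.
      by apply: agree_update; case=> // /esym.
    over.
  by rewrite -mulr_suml (Q_sum1 hQ) ?mul1r//= => /esym.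
rewrite exchange_big; apply: eq_bigr => a _.
under eq_bigr => b _.
  rewrite Est update_comm; last by apply/eqP.
  rewrite (@ratio_local [set t] [set u] _ (update w t a)); last first.
    by apply: agree_update; case.
  over.
by rewrite -mulr_suml (Q_sum1 hQ)// ?mul1r//= => /esym.
Qed.

(** The weights of a single site have total mass 1. The cocycle relation through
    a third site [u] separates the variables: the reciprocal of
    [inv_weight t [set s]] is [ratio [set s] [set u]] up to a factor that does
    not depend on the letter at [s], and [inv_weight_swap] gives the sum. *)
Lemma site_mass1 s t w : s <> t ->
  \sum_(b : A) (inv_weight t [set s] (update w s b))^-1 = 1.
Proof.
move=> st.
have [u nu] : exists u, ~ [set s; t] u.
  by apply: fresh_site; rewrite finite_setU; split.
have [us ut] : u <> s /\ u <> t by split=> h; apply: nu; [left|right].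
have n0 : inv_weight t [set u] w != 0.
  by rewrite gt_eqF// inv_weight_gt0//= => /esym.
under eq_bigr => b _.
  rewrite (@inv_weight_change t u)//; try by move=> /= /esym.
  rewrite (@inv_weight_local t [set u] _ w); last first.
    by apply: agree_update => /= /esym.
  rewrite invfM -ratio_inv.
  over.
rewrite -mulr_sumr -/(inv_weight s [set u] w).
rewrite (@inv_weight_swap s t)//; try by move=> /esym.
by rewrite mulVf.
Qed.

(** Passing from [t] to [s] multiplies by the total mass of the weights of the
    site [s] ([inv_weight_change]), which is 1. *)
Lemma inv_weight_indep s t S w : finite_set S -> S !=set0 -> ~ S s -> ~ S t ->
  inv_weight s S w = inv_weight t S w.
Proof.
move=> fS S0 Ss St; have [->//|/eqP st] := eqVneq s t.
rewrite -[RHS]mul1r -(@site_mass1 s t w)// mulr_suml; apply: eq_bigr => b _.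
rewrite -(@inv_weight_local t S (update w s b)); last exact: agree_update.
rewrite (@inv_weight_change t s S)//; last by move=> /esym.
by rewrite mulrA mulVf ?mul1r// gt_eqF// inv_weight_gt0//= => /esym.
Qed.

Lemma inv_weight_cat t S V w : finite_set S -> S !=set0 -> finite_set V ->
  V `<=` ~` S -> ~ S t -> ~ V t ->
  inv_weight t S w = inv_weight t (S `|` V) w * Q V S w.
Proof.
move=> fS S0 fV VS St Vt; rewrite /inv_weight mulr_suml; apply: eq_bigr => a _.
set x := update w t a.
have -> : Q V S w = Q V S x.
  by apply: (Q_local hQ); apply/agree_sym/agree_update => -[].
have E := @Q_exchange [set t] V S x.
rewrite /ratio (Q_cat hQ)//; try by disj.
have g1 : Q V ([set t] `|` S) x != 0.
  rewrite gt_eqF// (Q_gt0 hQ)//; first by exists t; left.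
  by move=> i Vi [/= it|/VS]; [subst|apply].
have g2 : Q S [set t] x != 0.
  by rewrite gt_eqF// (Q_gt0 hQ)// => i Si /= it; subst.
rewrite mulrAC [Q _ (S `|` V) x * _]mulrC -E//; try by move=> _ ->.
by rewrite setUC -[LHS](mulfK g1); field; rewrite g1 g2.
Qed.

(** The choice of the site outside [S] does not matter ([weightE]). The empty
    set needs its own clause because a specification has no empty boundary
    condition; infinite sets get a default value. *)
Definition weight S w : R :=
  if pselect (finite_set S /\ S !=set0) is left h
  then (inv_weight (projT1 (cid (fresh_site h.1))) S w)^-1 else 1.

Lemma weightE t S w : finite_set S -> S !=set0 -> ~ S t ->
  weight S w = (inv_weight t S w)^-1.
Proof.
move=> fS S0 St; rewrite /weight; case: pselect => [h|]; last by case.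
by case: cid => s Ss /=; rewrite (inv_weight_indep w fS S0 Ss St).
Qed.

Lemma weight_set0 w : weight set0 w = 1.
Proof. by rewrite /weight; case: pselect => // h; case: h.2. Qed.

Lemma weight_gt0 S w : finite_set S -> 0 < weight S w.
Proof.
move=> fS; have [->|/set0P S0] := eqVneq S set0; first by rewrite weight_set0.
have [t St] := fresh_site fS.
by rewrite (weightE w fS S0 St) invr_gt0 inv_weight_gt0.
Qed.

Lemma weight_local S w w' : finite_set S -> agree S w w' ->
  weight S w = weight S w'.
Proof.
move=> fS ww'; have [->|/set0P S0] := eqVneq S set0.
  by rewrite !weight_set0.
have [t St] := fresh_site fS.
by rewrite !(weightE _ fS S0 St) (inv_weight_local t ww').
Qed.

Lemma weight_cat S V w : finite_set S -> S !=set0 -> finite_set V ->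
  V `<=` ~` S -> weight (S `|` V) w = weight S w * Q V S w.
Proof.
move=> fS S0 fV VS.
have fSV : finite_set (S `|` V) by rewrite finite_setU.
have SV0 : S `|` V !=set0 by case: S0 => i; exists i; left.
have [t SVt] := fresh_site fSV.
have St : ~ S t by move=> ?; apply: SVt; left.
have Vt : ~ V t by move=> ?; apply: SVt; right.
rewrite (weightE w fSV SV0 SVt) (weightE w fS S0 St).
rewrite (inv_weight_cat w fS S0 fV VS St Vt) invfM divfK//.
by rewrite gt_eqF// (Q_gt0 hQ).
Qed.

Lemma consistent_weight : consistent weight.
Proof.
split.
- exact: weight_local.
- by move=> S w /weight_gt0/ltW.
- exact: weight_set0.
move=> S v w fS Sv; have [->|/set0P S0] := eqVneq S set0.
  have [t vt] := fresh_site (finite_set1 v).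
  under eq_bigr do rewrite setU0 (weightE _ _ _ vt)//.
  by rewrite weight_set0; apply: site_mass1 => /esym.
under eq_bigr => a _.
  rewrite setUC weight_cat//; last by move=> _ ->.
  rewrite (weight_local fS (agree_update _ _ Sv)).
  over.
by rewrite -mulr_sumr (Q_sum1 hQ)// mulr1.
Qed.

(** The computation that motivates [weight]: for such a [p] the ratios are
    [p [set t] w / p S w], and their sum over the letters at [t] is
    [1 / p S w]. *)
Lemma weight_unique (p : set I -> (I -> A) -> R) :
  (forall S w, finite_set S -> 0 < p S w) ->
  (forall S w w', finite_set S -> agree S w w' -> p S w = p S w') ->
  (forall v w, \sum_(a : A) p [set v] (update w v a) = 1) ->
  (forall S V w, finite_set S -> S !=set0 -> finite_set V -> V `<=` ~` S ->
     p (S `|` V) w = p S w * Q V S w) ->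
  forall S w, finite_set S -> S !=set0 -> p S w = weight S w.
Proof.
move=> p0 ploc p1 pcat S w fS S0.
have [t St] := fresh_site fS.
rewrite (weightE w fS S0 St) -[LHS]invrK; congr (_^-1).
rewrite -[LHS]mul1r -(p1 t w) mulr_suml; apply: eq_bigr => a _.
rewrite -(ploc S (update w t a))//; last exact: agree_update.
set x := update w t a; rewrite /ratio.
have tS : [set t] `<=` ~` S by move=> _ ->.
have St' : S `<=` ~` [set t] by move=> i Si /= it; subst.
apply/eqP; rewrite eqr_div; last 2 first.
- by rewrite gt_eqF// p0.
- by rewrite gt_eqF// (Q_gt0 hQ).
by rewrite -pcat// mulrC -pcat// setUC.
Qed.

End local_spec.

(** * Full specifications *)

Lemma infinite_site d : (1 <= d)%N -> infinite_set [set: site d].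
Proof.
case: d => // d _ fin; apply: infinite_nat.
pose f (t : site d.+1) := `|t ord0 ord0|%N.
apply: sub_finite_set (finite_image f fin).
by move=> n _; exists (const_mx n%:Z) => //; rewrite /f mxE.
Qed.

Section dictionary.
Context (d : nat) (R : realType) (X : {fset R}) (hX : (1 < #|` X|)%N).
Local Notation space := (field_space d hX).
Local Notation config := (site d -> letter hX).
Local Notation conf := (conf hX).
Local Notation restr S := (@restr d R X hX S).
Implicit Types (V S : set (site d)) (w : config).

Definition extend S (z : conf S) : config := fun i =>
  if pselect (S i) is left Si then z (SigSub (mem_set Si)) else point.

Lemma extendE S (z : conf S) (i : S) : extend z (val i) = z i.
Proof.
rewrite /extend; case: pselect => [Si|]; last by case; exact: set_valP.
by congr z; apply: val_inj.
Qed.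

Lemma extendK S (z : conf S) : restr S (extend z) = z.
Proof. by apply/funext => i; exact: extendE. Qed.

Lemma restr_agree S w w' : agree S w w' -> restr S w = restr S w'.
Proof. by move=> ww'; apply/funext => i; apply: ww'; exact: set_valP. Qed.

Lemma restr_eqE S w w' : restr S w = restr S w' <-> agree S w w'.
Proof.
split; last exact: restr_agree.
move=> ww' i Si; exact: (congr1 (fun f => f (SigSub (mem_set Si))) ww').
Qed.

Lemma common_extension V S (x : conf V) (z : conf S) : V `<=` ~` S ->
  exists w, x = restr V w /\ z = restr S w.
Proof.
move=> VS; exists (fun i => if pselect (V i) then extend x i else extend z i).
split; rewrite -[LHS]extendK; apply: restr_agree => i ii; case: pselect => //.
by move=> Vi; case: (VS i Vi ii).
Qed.

Lemma concat_restr V S w :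
  concat (restr V w) (restr S w) = restr (V `|` S) w.
Proof. by apply/funext => i; rewrite /concat; case: pselect. Qed.

Lemma restr_preimage S w : restr S @^-1` [set restr S w] = cylinder S w.
Proof. by apply/seteqP; split => f /restr_eqE. Qed.

Lemma pmass_restr (P : random_field d hX) V w :
  pmass P (restr V w) = fine (P (cylinder V w)).
Proof. by rewrite /pmass /marginal /pushforward restr_preimage. Qed.

Lemma measurable_restr S : measurable_fun setT (restr S : space -> conf S).
Proof.
apply: (@measurability _ _ space (conf S) _ _ (@cylinders S (letter hX))) => //.
move=> _ [_ [V fV [x ->]] <-]; rewrite setTI.
suff -> : restr S @^-1` [set f | forall i, V i -> f i = x i] =
    cylinder (val @` V) (extend x).
  by apply: measurable_cylinder; exact: finite_image.
apply/seteqP; split => f /= fx.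
  by move=> _ [i Vi <-]; rewrite extendE -(fx i Vi).
by move=> i Vi; rewrite -(extendE x); apply: fx; exists i.
Qed.

Section spec_family.
Context (q : spec_family d hX) (hq : full_specification q).

Definition spec_of V S w : R := q (restr S w) (restr V w).

Lemma local_spec_of : local_spec spec_of.
Proof.
split.
- move=> V S w w' ww'; rewrite /spec_of (@restr_agree S w w'); last first.
    by move=> i Si; apply: ww'; right.
  by rewrite (@restr_agree V w w')// => i Vi; apply: ww'; left.
- by move=> V S w fV S0 VS; apply: (spec_gt0 hq); split => // i Si /VS.
- move=> v S w S0 Sv.
  have adm : admissible [set v] S by split => // i Si /= iv; subst.
  rewrite -[RHS](spec_sum1 hq (restr S w) adm).
  rewrite (reindex_fsbigT (fun a => restr [set v] (update w v a))); last first.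
    exists (fun x => extend x v) => [a|x].
      have /restr_eqE := extendK (restr [set v] (update w v a)).
      by move=> /(_ v erefl); rewrite updateE.
    by rewrite -[RHS]extendK; apply: restr_agree => _ ->; exact: updateE.
  rewrite fsbig_finType; apply: eq_bigr => a _.
  by rewrite /spec_of (restr_agree (agree_update _ _ Sv)).
- move=> V T S w fV fT S0 VT VS TS; rewrite /spec_of -!concat_restr.
  apply: (spec_cat hq) => //.
    by rewrite -subset0 => i [/VT].
  split => //; first by rewrite finite_setU.
  by move=> i Si [/VS|/TS].
Qed.

Lemma cond_finE (P : random_field d hX) V S w :
  cond_fin P (restr S w) (restr V w) =
  fine (P (cylinder (V `|` S) w)) / fine (P (cylinder S w)).
Proof. by rewrite /cond_fin concat_restr !pmass_restr. Qed.

(** For a finite boundary set, almost every means every: each boundary condition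
    has positive probability. *)
Lemma specified_finite (P : random_field d hX) V S (z : conf S) (x : conf V) :
  positive_field P -> specified_by P q -> admissible V S -> finite_set S ->
  cond_fin P z x = q z x.
Proof.
move=> posP qP adm fS; apply: contrapT => neq.
have [N [mN N0 subN]] := qP V S adm.
have Nz : N z.
  by apply: subN => /= h; apply: neq; exact: (h x).1.
have := posP S z fS; rewrite /pmass; suff -> : marginal P [set z] = 0%E.
  by rewrite ltxx.
have mpre (B : set (conf S)) : measurable B -> measurable (restr S @^-1` B).
  by move=> mB; rewrite -[X in measurable X]setTI; exact: measurable_restr.
apply/eqP; rewrite -[_ == _](measure_le0 P) -N0 le_measure ?inE//.
- by rewrite -(extendK z) restr_preimage; exact: measurable_cylinder.
- exact: mpre.
- by move=> f /= ->.
Qed.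

(** For an infinite boundary set, the sequence whose limit defines the
    conditional probability is the one in the continuity axiom. *)
Lemma cond_prob_spec (P : random_field d hX) :
  (forall V S (z : conf S) (x : conf V), admissible V S -> finite_set S ->
    cond_fin P z x = q z x) ->
  specified_by P q.
Proof.
move=> condP V S adm; exists set0; split => //.
  by rewrite /marginal /pushforward preimage_set0 measure0.
move=> z /=; apply=> x; split => [fS|_ L LS fL L0 Linc Lcup].
  exact: condP.
have [fV S0 VS] := adm.
have -> : (fun n => cond_fin P (sub_restr (LS n) z) x) =
          (fun n => q (sub_restr (LS n) z) x).
  apply/funext => n; apply: condP => //.
  by split => // i /LS /VS.
exact: (spec_lim hq).
Qed.

End spec_family.
End dictionary.

Theorem theorem13 (R : realType) (d : nat) (hd : (1 <= d)%N)
    (X : {fset R}) (hX : (1 < #|` X|)%N) (q : spec_family d hX)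
    (hq : full_specification q) :
  exists P : random_field d hX,
    [/\ positive_field P,
        specified_by P q,
        forall (V S : set (site d)) (z : conf hX S) (x : conf hX V),
          admissible V S -> finite_set S -> cond_fin P z x = q V S z x
      & forall P' : random_field d hX,
          positive_field P' -> specified_by P' q -> same_field P' P].
Proof.
have hQ := local_spec_of hq.
have infI := infinite_site hd.
have hp := consistent_weight hQ infI.
have [P PE] := random_field_extension hp.
have condP (V S : set (site d)) (z : conf hX S) (x : conf hX V) :
    admissible V S -> finite_set S -> cond_fin P z x = q V S z x.
  move=> [fV S0 SV] fS.
  have VS : V `<=` ~` S by move=> i Vi /SV.
  have [w [-> ->]] := common_extension x z VS.
  rewrite cond_finE !PE ?finite_setU//= setUC (weight_cat hQ)//.
  by rewrite mulrAC divff ?mul1r// gt_eqF// (weight_gt0 hQ).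
exists P; split => //.
- move=> V x fV; rewrite -(extendK x) pmass_restr PE//=.
  exact: (weight_gt0 hQ).
- exact (cond_prob_spec hq condP).
move=> P' posP' qP'; apply: eq_cylinder_measure => V w fV.
pose p S w := fine (P' (cylinder S w)).
have pE S x : finite_set S -> P' (cylinder S x) = (p S x)%:E.
  by move=> fS; rewrite fineK// fin_num_measure//; exact: measurable_cylinder.
rewrite PE//; have [->|/set0P V0] := eqVneq V set0.
  by rewrite weight_set0 cylinder_set0 probability_setT.
rewrite pE//; congr (_%:E); apply: (weight_unique hQ) => //.
- by move=> S x fS; rewrite /p -pmass_restr; exact: posP'.
- move=> S x x' fS xx'; rewrite /p; congr (fine (P' _)).
  by rewrite -!restr_preimage (restr_agree xx').
- move=> v x; apply/EFin_inj; rewrite -sumEFin -(probability_setT P').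
  rewrite -(cylinder_set0 x).
  rewrite (@measure_cylinder_split _ _ _ _ _ _ v)//.
  by apply: eq_bigr => a _; rewrite setU0; exact/esym/pE.
move=> S T x fS S0 fT TS.
rewrite /spec_of -(specified_finite _ _ posP' qP')//; last first.
  by split => // i Si /TS.
rewrite cond_finE setUC -/(p _ _) -/(p _ _) mulrC divfK//.
by rewrite gt_eqF// /p -pmass_restr; exact: posP'.
Qed.
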